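(* Fix arbitrary sets $D_i$ ($0\le i\le5$), $D_6^L$, $D_6^R$, $D_8$ of left coset representatives of $N_i$, $N_6^L$, $N_6^R$, $N_8$ in $W(\mathrm{F}_4)$, and put $D_7^L=D_6^R$, $D_7^R=D_6^L$, $C_7=C_6$, $D_9^L=D_5$, $D_9^R=D_4$, $D_{10}^L=D_4$, $D_{10}^R=D_5$; for a set $D$ write $D^{-1}=\{d^{-1}:d\in D\}$. Then every monomial $a\in\mathrm{BrM}(\mathrm{F}_4)$ equals $\delta^k$ times an element of one of the following forms, for some $k\in\mathbb Z$: (I) $u\,e_{X_i}\,v\,w$ with $0\le i\le5$, $u\in D_i$, $v\in C_i$, $w\in D_i^{-1}$; (II) $u\,e_3e_2\,v\,w$ with $u\in D_6^L$, $v\in C_6$, $w\in(D_6^R)^{-1}$; (III) $u\,e_2e_3\,v\,w$ with $u\in D_7^L$, $v\in C_7$, $w\in(D_7^R)^{-1}$; (IV) $u\,e_4r_3e_2e_3e_4\,w$ with $u\in D_8$, $w\in D_8^{-1}$; (V) $u\,e_3e_2e_1e_3\,w$ with $u\in D_9^L$, $w\in(D_9^R)^{-1}$; (VI) $u\,e_3e_1e_2e_3\,w$ with $u\in D_{10}^L$, $w\in(D_{10}^R)^{-1}$.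
   Context: $\mathrm{Br}(\mathrm{F}_4)$ is the unital associative $\mathbb Z[\delta^{\pm1}]$-algebra ($\delta$ an indeterminate) generated by $r_1,\dots,r_4,e_1,\dots,e_4$ subject to: $r_i^2=1$, $r_ie_i=e_ir_i=e_i$ for all $i$; $e_i^2=\delta e_i$ for $i\in\{3,4\}$; $e_i^2=\delta^2e_i$ for $i\in\{1,2\}$; for $\{i,j\}\in\{\{1,3\},\{1,4\},\{2,4\}\}$: $r_ir_j=r_jr_i$, $e_ir_j=r_je_i$, $e_ie_j=e_je_i$; for $(i,j)\in\{(1,2),(2,1),(3,4),(4,3)\}$: $r_ir_jr_i=r_jr_ir_j$, $r_jr_ie_j=e_ie_j$, $r_ie_jr_i=r_je_ir_j$; and $r_2r_3r_2r_3=r_3r_2r_3r_2$, $r_2r_3e_2=r_3e_2$, $r_2e_3r_2e_3=e_3e_2e_3$, $(r_2r_3r_2)e_3=e_3(r_2r_3r_2)$, $e_2r_3e_2=\delta e_2$, $e_2e_3e_2=\delta e_2$, $e_2r_3r_2=e_2r_3$, $e_2e_3r_2=e_2e_3$. $\mathrm{BrM}(\mathrm{F}_4)$ is the monoid generated by $\delta^{\pm1}$ and the $r_i,e_i$. Roots: $\epsilon_1,\dots,\epsilon_4$ standard basis of $\mathbb R^4$; $\beta_1=\frac12(\epsilon_1-\epsilon_2-\epsilon_3-\epsilon_4)$, $\beta_2=\epsilon_2$, $\beta_3=\epsilon_3-\epsilon_2$, $\beta_4=\epsilon_4-\epsilon_3$; $\Psi$ the $\mathrm{F}_4$ root system $\{\pm\epsilon_i\}\cup\{\pm\epsilon_i\pm\epsilon_j:i<j\}\cup\{\frac12(\pm\epsilon_1\pm\epsilon_2\pm\epsilon_3\pm\epsilon_4)\}$,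 $\Psi^+$ its roots that are nonnegative combinations of the $\beta_i$; a root and its negative are identified when naming positive roots. $W(\mathrm{F}_4)$ is generated by the reflections $s_{\beta_i}$ and identified with its image in $\mathrm{Br}(\mathrm{F}_4)$ via $s_{\beta_i}\mapsto r_i$; $r_\beta$ denotes the reflection in the root $\beta$. For $\beta\in\Psi^+$, $e_\beta:=we_jw^{-1}$ for any $w$, $j$ with $w\beta_j=\beta$ (well defined), and $e_X=\prod_{\beta\in X}e_\beta$ for the sets below (factors commute). Sets: $X_0=\emptyset$, $X_1=\{\beta_4\}$, $X_2=\{\beta_1\}$, $X_3=\{\epsilon_3-\epsilon_2,\epsilon_3+\epsilon_2\}$, $X_4=\{\beta_1,\beta_3,\epsilon_1+\epsilon_4\}$, $X_5=\{\epsilon_3-\epsilon_2,\epsilon_3+\epsilon_2,\epsilon_4+\epsilon_1,\epsilon_4-\epsilon_1\}$. Subgroups: $N_0=C_0=W(\mathrm{F}_4)$; $N_1=\langle r_1,r_2,r_{\epsilon_4+\epsilon_3},r_4\rangle$, $C_1=\langle r_1,r_2,r_{\epsilon_4+\epsilon_3}\rangle$; $N_2=\langle r_1,r_3,r_4,r_{(\epsilon_1+\epsilon_2+\epsilon_3-\epsilon_4)/2}\rangle$, $C_2=\langle r_3,r_4\rangle$; $N_3=\langle r_2,r_3,r_{\epsilon_4},r_{\epsilon_4-\epsilon_1}\rangle$, $C_3=\langle r_{\epsilon_4-\epsilon_1}\rangle$; $N_4=\langle r_3,r_1,r_{(\epsilon_1+\epsilon_2+\epsilon_3-\epsilon_4)/2},r_{(\epsilon_1-\epsilon_2+\epsilon_3+\epsilon_4)/2}\rangle$,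 $C_4=\{1\}$; $N_5=\langle r_1,r_2,r_3,r_{\epsilon_4},r_{\epsilon_1}\rangle$, $C_5=\{1\}$; $N_6^L=\langle r_2,r_3,r_{\epsilon_4},r_{\epsilon_4-\epsilon_1}\rangle$, $N_6^R=\langle r_2,r_{\epsilon_3},r_{\epsilon_4},r_{\epsilon_4-\epsilon_1}\rangle$, $C_6=\langle r_{\epsilon_4-\epsilon_1}\rangle$, $N_8=\langle r_2,r_4,r_{\epsilon_1},r_{\epsilon_3}\rangle$. *)

(* Defs.v *)
(* Br(F4) monoid as words modulo the congruence generated by
   the defining relations (plus delta central and invertible);
   W(F4) as a group of 4x4 rational matrices acting on column vectors. *)
From HB Require Import structures.
From mathcomp Require Import all_boot all_order all_algebra.
Set Implicit Arguments. Unset Strict Implicit. Unset Printing Implicit Defensive.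
Import GRing.Theory.
Local Open Scope ring_scope.

Definition vec := 'cV[rat]_4.
Definition mat := 'M[rat]_4.

Definition eps (i : 'I_4) : vec := delta_mx i 0.
Definition eps1 : vec := eps (@Ordinal 4 0 isT).
Definition eps2 : vec := eps (@Ordinal 4 1 isT).
Definition eps3 : vec := eps (@Ordinal 4 2 isT).
Definition eps4 : vec := eps (@Ordinal 4 3 isT).
Definition half : rat := (2%:R)^-1.

Definition beta1 : vec := half *: (eps1 - eps2 - eps3 - eps4).
Definition beta2 : vec := eps2.
Definition beta3 : vec := eps3 - eps2.
Definition beta4 : vec := eps4 - eps3.

Definition dot (a b : vec) : rat := \sum_(i < 4) a i 0 * b i 0.
Definition refl (a : vec) : mat := 1%:M - (2%:R / dot a a) *: (a *m a^T).

Inductive node := n1 | n2 | n3 | n4.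
Definition beta (n : node) : vec :=
  match n with n1 => beta1 | n2 => beta2 | n3 => beta3 | n4 => beta4 end.

Definition wmat (s : seq node) : mat := foldr (fun n M => refl (beta n) *m M) 1%:M s.

(* subgroup generated by the reflections in the roots of L (products of
   involutions, so the generated monoid is the generated group) *)
Definition gen_by (L : seq vec) (g : mat) : Prop :=
  exists s : seq vec, all (fun a => a \in L) s /\
                      g = foldr (fun a M => refl a *m M) 1%:M s.

Definition inW : mat -> Prop := gen_by [:: beta1; beta2; beta3; beta4].

Definition coset_reps (N D : mat -> Prop) : Prop :=
  (forall d, D d -> inW d) /\
  (forall g, inW g -> exists d, (D d /\ N (invmx d *m g)) /\
                      forall d', D d' -> N (invmx d' *m g) -> d' = d).

Definition N0 := inW.
Definition C0 := inW.
Definition N1 := gen_by [:: beta1; beta2; eps4 + eps3; beta4].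
Definition C1 := gen_by [:: beta1; beta2; eps4 + eps3].
Definition N2 := gen_by [:: beta1; beta3; beta4; half *: (eps1 + eps2 + eps3 - eps4)].
Definition C2 := gen_by [:: beta3; beta4].
Definition N3 := gen_by [:: beta2; beta3; eps4; eps4 - eps1].
Definition C3 := gen_by [:: eps4 - eps1].
Definition N4 := gen_by [:: beta3; beta1; half *: (eps1 + eps2 + eps3 - eps4);
                            half *: (eps1 - eps2 + eps3 + eps4)].
Definition C4 := gen_by [::].
Definition N5 := gen_by [:: beta1; beta2; beta3; eps4; eps1].
Definition C5 := gen_by [::].
Definition N6L := gen_by [:: beta2; beta3; eps4; eps4 - eps1].
Definition N6R := gen_by [:: beta2; eps3; eps4; eps4 - eps1].
Definition C6 := gen_by [:: eps4 - eps1].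
Definition N8 := gen_by [:: beta2; beta4; eps1; eps3].

Definition X0 : seq vec := [::].
Definition X1 : seq vec := [:: beta4].
Definition X2 : seq vec := [:: beta1].
Definition X3 : seq vec := [:: eps3 - eps2; eps3 + eps2].
Definition X4 : seq vec := [:: beta1; beta3; eps1 + eps4].
Definition X5 : seq vec := [:: eps3 - eps2; eps3 + eps2; eps4 + eps1; eps4 - eps1].

Inductive letter := R of node | E of node | Dl | Dli.
Definition word := seq letter.

Definition comm_pair (i j : node) : Prop :=
  (i = n1 /\ j = n3) \/ (i = n3 /\ j = n1) \/ (i = n1 /\ j = n4) \/ (i = n4 /\ j = n1) \/
  (i = n2 /\ j = n4) \/ (i = n4 /\ j = n2).
Definition braid_pair (i j : node) : Prop :=
  (i = n1 /\ j = n2) \/ (i = n2 /\ j = n1) \/ (i = n3 /\ j = n4) \/ (i = n4 /\ j = n3).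

Inductive brel : word -> word -> Prop :=
| rel_dd : brel [:: Dl; Dli] [::]
| rel_dd' : brel [:: Dli; Dl] [::]
| rel_dcentral x : brel [:: Dl; x] [:: x; Dl]
| rel_rr i : brel [:: R i; R i] [::]
| rel_re i : brel [:: R i; E i] [:: E i]
| rel_er i : brel [:: E i; R i] [:: E i]
| rel_ee_short i : i = n3 \/ i = n4 -> brel [:: E i; E i] [:: Dl; E i]
| rel_ee_long i : i = n1 \/ i = n2 -> brel [:: E i; E i] [:: Dl; Dl; E i]
| rel_c_rr i j : comm_pair i j -> brel [:: R i; R j] [:: R j; R i]
| rel_c_er i j : comm_pair i j -> brel [:: E i; R j] [:: R j; E i]
| rel_c_ee i j : comm_pair i j -> brel [:: E i; E j] [:: E j; E i]
| rel_b_rrr i j : braid_pair i j -> brel [:: R i; R j; R i] [:: R j; R i; R j]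
| rel_b_rre i j : braid_pair i j -> brel [:: R j; R i; E j] [:: E i; E j]
| rel_b_rer i j : braid_pair i j -> brel [:: R i; E j; R i] [:: R j; E i; R j]
| rel_23_a : brel [:: R n2; R n3; R n2; R n3] [:: R n3; R n2; R n3; R n2]
| rel_23_b : brel [:: R n2; R n3; E n2] [:: R n3; E n2]
| rel_23_c : brel [:: R n2; E n3; R n2; E n3] [:: E n3; E n2; E n3]
| rel_23_d : brel [:: R n2; R n3; R n2; E n3] [:: E n3; R n2; R n3; R n2]
| rel_23_e : brel [:: E n2; R n3; E n2] [:: Dl; E n2]
| rel_23_f : brel [:: E n2; E n3; E n2] [:: Dl; E n2]
| rel_23_g : brel [:: E n2; R n3; R n2] [:: E n2; R n3]
| rel_23_h : brel [:: E n2; E n3; R n2] [:: E n2; E n3].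

Inductive breq : word -> word -> Prop :=
| breq_refl x : breq x x
| breq_sym x y : breq x y -> breq y x
| breq_trans x y z : breq x y -> breq y z -> breq x z
| breq_ctx u v x y : brel x y -> breq (u ++ x ++ v) (u ++ y ++ v).

Definition dpow (k : int) : word :=
  match k with Posz n => nseq n Dl | Negz n => nseq n.+1 Dli end.

(* x is (a word for) the image of g in Br(F4) under s_{beta_i} |-> r_i *)
Definition img (g : mat) (x : word) : Prop :=
  exists s : seq node, wmat s = g /\ x = map R s.

(* x is a word for e_b = w e_j w^{-1}, where w beta_j = +-b *)
Definition ebeta (b : vec) (x : word) : Prop :=
  exists (s : seq node) (j : node),
    (wmat s *m beta j = b \/ wmat s *m beta j = - b) /\
    x = map R s ++ E j :: map R (rev s).

Fixpoint eprod (X : seq vec) (x : word) : Prop :=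
  match X with
  | [::] => x = [::]
  | b :: X' => exists xb x', [/\ ebeta b xb, eprod X' x' & x = xb ++ x']
  end.

Definition form_v (DL : mat -> Prop) (Xw : word -> Prop) (C DR : mat -> Prop)
    (b : word) : Prop :=
  exists (u v d : mat) (xu xm xv xw : word),
    [/\ DL u, C v, DR d, Xw xm &
     [/\ img u xu, img v xv, img (invmx d) xw & b = xu ++ xm ++ xv ++ xw]].

Definition form_nov (DL : mat -> Prop) (Xw : word -> Prop) (DR : mat -> Prop)
    (b : word) : Prop :=
  exists (u d : mat) (xu xm xw : word),
    [/\ DL u, DR d, Xw xm &
     [/\ img u xu, img (invmx d) xw & b = xu ++ xm ++ xw]].

(* Main.v *)
From Stdlib Require Import Ascii String Setoid Morphisms.
Require Import Defs.
From HB Require Import structures.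
From mathcomp Require Import all_boot all_order all_algebra ring lra.
Set Implicit Arguments. Unset Strict Implicit. Unset Printing Implicit Defensive.

(* Work modulo powers of delta. The elements e_beta are permuted by conjugation with the
   r_i, so e_i u = u e_beta for every word u in the r_i and some root beta. Hence the set of
   all u y w, with u and w words in the r_i and y one of the eleven middle factors, is closed
   under left multiplication by e_i as soon as each e_beta y lies in it. Elements s of the
   group N attached to y satisfy s y = y s' with s' in N, so one root beta per N-orbit is
   enough; this leaves 62 identities between explicit words. They hold because both sides
   have the same normal form for rewriting rules derived from the presentation.
   To pass from words u, w to coset representatives, write u = d n with n in N as a word in
   the generators of N and choose u n^-1 as the word for d; the letters of n are then
   absorbed by y or moved into C. *)

(** * The monoid up to powers of delta *)

(* The induced shortlex order keeps the list of overlaps below short. *)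
Definition code (x : letter) : nat :=
  match x with
  | E n4 => 0 | E n3 => 1 | E n2 => 2 | E n1 => 3
  | R n4 => 4 | R n3 => 5 | R n2 => 6 | R n1 => 7
  | Dl => 8 | Dli => 9
  end.

Lemma code_inj : injective code.
Proof. by case=> [[]|[]||] [[]|[]||]. Qed.

HB.instance Definition _ := Equality.copy letter (inj_type code_inj).

Lemma R_inj : injective R.
Proof. by move=> i j []. Qed.

HB.instance Definition _ := Equality.copy node (inj_type R_inj).

Definition is_delta (x : letter) : bool := match x with Dl | Dli => true | _ => false end.

Lemma breq_cat2 u v x y : breq x y -> breq (u ++ x ++ v) (u ++ y ++ v).
Proof.
elim=> [z|{}x {}y _ /breq_sym//|{}x {}y z _ ? _|s t l r lr]; first exact: breq_refl.
  exact: breq_trans.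
by rewrite -!catA !(catA u); apply: breq_ctx.
Qed.

Lemma breq_brel x y : brel x y -> breq x y.
Proof. by move=> /(breq_ctx [::] [::]); rewrite /= !cats0. Qed.

(** Only [Dl] is central by a defining relation. For [Dli], insert [Dl Dli] behind [y], move this
    [Dl] in front of [y] and cancel [Dli Dl]. *)
Lemma delta_swap x y : is_delta x -> breq [:: x; y] [:: y; x].
Proof.
case: x => // _; first exact/breq_brel/rel_dcentral.
apply: (@breq_trans _ [:: Dli; y; Dl; Dli]).
  exact/breq_sym/(breq_ctx [:: Dli; y] [::] rel_dd).
apply: (@breq_trans _ [:: Dli; Dl; y; Dli]).
  exact/breq_sym/(breq_ctx [:: Dli] [:: Dli] (rel_dcentral y)).
exact: (breq_ctx [::] [:: y; Dli] rel_dd').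
Qed.

Lemma delta_central d w : all is_delta d -> breq (d ++ w) (w ++ d).
Proof.
elim: d => [|x d IHd] /=; first by rewrite cats0 => _; exact: breq_refl.
case/andP=> dx dd.
apply: (@breq_trans _ (x :: w ++ d)).
  by have := breq_cat2 [:: x] [::] (IHd dd); rewrite !cats0.
elim: w {IHd} => [|y w IHw]; first exact: breq_refl.
apply: (@breq_trans _ (y :: x :: w ++ d)).
  exact: (breq_cat2 [::] (w ++ d) (delta_swap y dx)).
by have := breq_cat2 [:: y] [::] IHw; rewrite !cats0.
Qed.

Lemma delta_inverse d : all is_delta d -> exists2 d', all is_delta d' & breq (d' ++ d) [::].
Proof.
elim: d => [|x d IHd] /=; first by exists [::] => //; exact: breq_refl.
case/andP=> dx /IHd[d' dd' d'd].
have [y dy yx] : exists2 y, is_delta y & breq [:: y; x] [::].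
  by case: x dx => // _; [exists Dli | exists Dl] => //; apply: breq_brel; constructor.
exists (d' ++ [:: y]); first by rewrite all_cat dd' /= dy.
rewrite -catA; apply: breq_trans d'd.
exact: (breq_cat2 d' d yx).
Qed.

(** Equality up to a power of $\delta$. Any word in [Dl] and [Dli] may serve as the factor, so
    products need no exponent arithmetic; the exponent is recovered once, in [peq_dpow]. *)
Definition peq (a b : word) : Prop := exists2 d, all is_delta d & breq a (d ++ b).

Lemma peq_refl a : peq a a.
Proof. by exists [::] => //; exact: breq_refl. Qed.

Lemma peq_sym a b : peq a b -> peq b a.
Proof.
case=> d dd ab; have [d' dd' d'd] := delta_inverse dd.
exists d' => //; apply: breq_sym.
apply: (@breq_trans _ (d' ++ d ++ b)).
  by have := breq_cat2 d' [::] ab; rewrite !cats0.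
by have := breq_cat2 [::] b d'd; rewrite /= -catA.
Qed.

Lemma peq_trans a b c : peq a b -> peq b c -> peq a c.
Proof.
case=> d dd ab [d' dd' bc]; exists (d ++ d'); first by rewrite all_cat dd.
apply: breq_trans ab _; rewrite -catA.
by have := breq_cat2 d [::] bc; rewrite !cats0.
Qed.

Lemma peq_cat a a' b b' : peq a a' -> peq b b' -> peq (a ++ b) (a' ++ b').
Proof.
case=> d dd aa' [d' dd' bb']; exists (d ++ d'); first by rewrite all_cat dd.
apply: (@breq_trans _ ((d ++ a') ++ b)); first exact: (breq_cat2 [::] b aa').
rewrite -!catA; apply: (@breq_trans _ (d ++ a' ++ d' ++ b')).
  by have := breq_cat2 (d ++ a') [::] bb'; rewrite !cats0 -!catA.
by apply: breq_sym; have := breq_cat2 d b' (delta_central a' dd'); rewrite -!catA.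
Qed.

#[local] Instance peq_equivalence : Equivalence peq.
Proof. by split; [exact: peq_refl | exact: peq_sym | exact: peq_trans]. Qed.

#[local] Instance cat_peq : Proper (peq ==> peq ==> peq) (@cat letter).
Proof. by move=> a a' aa' b b'; apply: peq_cat. Qed.

Lemma breq_peq a b : breq a b -> peq a b.
Proof. by exists [::]. Qed.

Lemma peq_delta d w : all is_delta d -> peq (d ++ w) w.
Proof. by move=> dd; exists d => //; exact: breq_refl. Qed.

Lemma peq_dpow a b : peq a b -> exists k : int, breq a (dpow k ++ b).
Proof.
suff delta_dpow d : all is_delta d -> exists k : int, breq d (dpow k).
  case=> d /delta_dpow[k dk] ab; exists k; apply: breq_trans ab _.
  exact: (breq_cat2 [::] b dk).
elim: d => [|x d IHd] /=; first by exists (Posz 0); exact: breq_refl.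
case/andP=> dx /IHd[k dk].
suff [l kl] : exists l : int, breq (x :: dpow k) (dpow l).
  exists l; apply: breq_trans kl.
  by have := breq_cat2 [:: x] [::] dk; rewrite !cats0.
(* [Negz n] stands for $-(n+1)$, so the constructor changes exactly when the exponent passes between
   $-1$ and $0$. *)
case: x k dx {dk} => // [[n|[|n]] _|[[|n]|n] _].
- by exists (Posz n.+1); exact: breq_refl.
- by exists (Posz 0); exact/breq_brel/rel_dd.
- by exists (Negz n); exact: (breq_ctx [::] (nseq n.+1 Dli) rel_dd).
- by exists (Negz 0); exact: breq_refl.
- by exists (Posz n); exact: (breq_ctx [::] (nseq n Dl) rel_dd').
- by exists (Negz n.+1); exact: breq_refl.
Qed.

(** * A verified rewriting system *)

(* Digits stand for the r_i, the letters a, b, c, d for e_1, e_2, e_3, e_4. *)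
Definition letter_of (c : Ascii.ascii) : letter :=
  match c with
  | "1" => R n1 | "2" => R n2 | "3" => R n3 | "4" => R n4
  | "a" => E n1 | "b" => E n2 | "c" => E n3 | "d" => E n4
  | _ => Dl
  end%char.

Definition wd (s : string) : word := map letter_of (list_ascii_of_string s).

(* The left-hand side of a rule is stored reversed, as it is matched against a stack. *)
Definition rule : Type := word * word.

Fixpoint drop_prefix (l s : word) : option word :=
  match l, s with
  | [::], _ => Some s
  | x :: l', y :: s' => if x == y then drop_prefix l' s' else None
  | _ :: _, [::] => None
  end.

Fixpoint contract (rs : seq rule) (o : word) : option (word * word) :=
  if rs is (l, r) :: rs' then
    if drop_prefix l o is Some o' then Some (o', r) else contract rs' o
  else None.

(** The stack [o] holds an irreducible word, last letter first, so a redex can only end at the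
    letter just pushed. A right-hand side returns to the input, since it may form new redexes with
    the stack. *)
Fixpoint normalize_from (rs : seq rule) (fuel : nat) (o inp : word) : word :=
  match fuel, inp with
  | k.+1, x :: inp' =>
    if contract rs (x :: o) is Some (o', r) then normalize_from rs k o' (r ++ inp')
    else normalize_from rs k (x :: o) inp'
  | _, _ => catrev o inp
  end.

(* Too little fuel would only leave the word unreduced. *)
Definition normalize (rs : seq rule) (w : word) : word := normalize_from rs 2000 [::] w.

(** All rules are tried at all places, so a critical pair shows up as two reducts of its overlap
    word; [k] is the position where the match ends. *)
Definition reducts (rs : seq rule) (p : word) : seq word :=
  flatten [seq pmap (fun lr => omap (fun o => catrev o (lr.2 ++ drop k p))
                                    (drop_prefix lr.1 (rev (take k p)))) rs
          | k <- iota 0 (size p).+1].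

Fixpoint lex (v w : word) : bool :=
  match v, w with
  | x :: v', y :: w' => (code x < code y) || (x == y) && lex v' w'
  | [::], _ => true
  | _, _ => false
  end.
Definition shortlex (v w : word) : bool :=
  (size v < size w) || (size v == size w) && lex v w.
Definition smaller v w := if shortlex v w then v else w.
Definition orient (v w : word) : rule :=
  if shortlex v w then (rev w, v) else (rev v, w).

(* The reducts of p are equal, so their distinct normal forms give new rules. *)
Definition resolve (rs : seq rule) (p : word) : seq rule :=
  let ns := undup [seq normalize rs q | q <- reducts rs p] in
  let m := foldr smaller (head [::] ns) ns in
  [seq orient q m | q <- ns & q != m] ++ rs.

Definition nodes := [:: n1; n2; n3; n4].
Definition commuting := [:: (n1, n3); (n3, n1); (n1, n4); (n4, n1); (n2, n4); (n4, n2)].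
Definition braided := [:: (n1, n2); (n2, n1); (n3, n4); (n4, n3)].

(* Powers of delta are dropped from the defining relations. *)
Definition relations : seq (word * word) :=
  flatten [seq [:: ([:: R i; R i], [::]); ([:: R i; E i], [:: E i]);
                   ([:: E i; R i], [:: E i]); ([:: E i; E i], [:: E i])] | i <- nodes] ++
  flatten [seq [:: ([:: R p.1; R p.2], [:: R p.2; R p.1]);
                   ([:: E p.1; R p.2], [:: R p.2; E p.1]);
                   ([:: E p.1; E p.2], [:: E p.2; E p.1])] | p <- commuting] ++
  flatten [seq [:: ([:: R p.1; R p.2; R p.1], [:: R p.2; R p.1; R p.2]);
                   ([:: R p.2; R p.1; E p.2], [:: E p.1; E p.2]);
                   ([:: R p.1; E p.2; R p.1], [:: R p.2; E p.1; R p.2])] | p <- braided] ++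
  [seq (wd p.1, wd p.2) | p <-
    [:: ("2323", "3232"); ("23b", "3b"); ("2c2c", "cbc"); ("232c", "c232");
        ("b3b", "b"); ("bcb", "b"); ("b32", "b3"); ("bc2", "bc")]]%string.

(* The overlaps of a Knuth-Bendix completion, found by an external search and then thinned
   out, whose resolution decides the word identities needed here. *)
Definition overlaps : seq string :=
  [:: "c3a"; "24a"; "14b"; "1213"; "121c"; "11b1"; "1b13"; "1b1c"; "21b1"; "112a";
      "a12a"; "12ac"; "443d"; "243d"; "33d3"; "43d3"; "334c"; "c34c"; "4bcb";
      "b324"; "4b32"; "b32d"; "bc24"; "bc2d"; "ba22"; "ab11"; "ab13"; "ab1c";
      "21ba"; "34cd"; "dc44"; "dc4b"; "2dc4"; "cd33"; "cd3a"; "43dc"; "a213";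
      "3a21"; "a21c"; "bdcd"; "2dcd"; "bd34"; "2d34"; "c43a"; "2323a"; "22c2c";
      "2232c"; "bc21b"; "12314"; "12c14"; "1b314"; "1bc1d"; "1423d"; "abc1d";
      "ad2c4"; "a231d"; "a321c"; "1d2cd"; "ad234"; "1d234"; "2cbcb"; "2cbc2";
      "c2c2c"; "c2cb"; "ac2c"; "1c2c"; "232343"; "2323d3"; "123121"; "12c121";
      "1231ba"; "2323dc"; "b1232c"; "ab3121"; "ab312a"; "dcb4cd"; "232c43";
      "2c2322"; "1232a4"; "a23214"; "4a2321"; "a232a4"; "ad3bcd"; "2c2343";
      "2c23d3"; "2c23dc"; "12c4121"; "ac23423"; "a234213"; "34323d2c"; "12341232a";
      "12c4212cb"; "a23423121"; "12c4212323"; "212c42c1b4"; "12c42312324"]%string.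

Definition completed : seq rule :=
  foldl resolve [seq orient p.1 p.2 | p <- relations] [seq wd p | p <- overlaps].
(** Stored as an evaluated list, so that later normalizations do not repeat the completion;
    [crulesE] compares the list with its definition. *)
Definition crules : seq rule := Eval vm_compute in completed.
Definition nf := normalize crules.

(** * Soundness of the completed rules *)

Definition sound (rs : seq rule) : Prop := forall p, p \in rs -> peq (rev p.1) p.2.

Lemma relations_sound p : p \in relations -> peq p.1 p.2.
Proof.
(* The listed pairs arise from the defining relations by dropping zero, one or two factors
   $\delta$. *)
have e0 a b : brel a b -> peq a b by move/breq_brel/breq_peq.
have e1 a b : brel a (Dl :: b) -> peq a b.
  by move/e0 => ab; apply: peq_trans ab _; apply: (@peq_delta [:: Dl]).
have e2 a b : brel a [:: Dl, Dl & b] -> peq a b.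
  by move/e0 => ab; apply: peq_trans ab _; apply: (@peq_delta [:: Dl; Dl]).
rewrite /relations !mem_cat => /or4P[] /=; rewrite !inE => H;
  repeat case/orP: H => H; rewrite ?(eqP H) //=.
all: try by apply: e0; constructor; rewrite /comm_pair /braid_pair; tauto.
all: try by apply: e1; constructor; tauto.
all: by apply: e2; constructor; tauto.
Qed.

Lemma drop_prefixP l s t : drop_prefix l s = Some t -> s = l ++ t.
Proof.
elim: l s => [|x l IHl] s /=; first by case.
by case: s => // y s; case: eqP => // <- /IHl ->.
Qed.

Lemma contract_sound rs o o' r : sound rs ->
  contract rs o = Some (o', r) -> peq (rev o) (rev o' ++ r).
Proof.
elim: rs => //= -[l r'] rs IHrs rs_sound.
case eq_o: drop_prefix => [t|].
  case=> <- <-; rewrite (drop_prefixP eq_o) rev_cat.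
  by apply: peq_cat; [exact: peq_refl | apply: (rs_sound (l, r')); rewrite inE eqxx].
by apply: IHrs => p p_rs; apply: rs_sound; rewrite inE p_rs orbT.
Qed.

Lemma normalize_from_sound rs k o inp : sound rs ->
  peq (normalize_from rs k o inp) (rev o ++ inp).
Proof.
move=> rs_sound; elim: k o inp => [|k IHk] o [|x inp] /=;
  try by rewrite catrevE; exact: peq_refl.
case eq_o: contract => [[o' r]|]; apply: peq_trans (IHk _ _) _; last first.
  by rewrite rev_cons cat_rcons; exact: peq_refl.
rewrite catA -cat_rcons -rev_cons; apply: peq_cat; last exact: peq_refl.
exact/peq_sym/(contract_sound rs_sound eq_o).
Qed.

Lemma normalize_sound rs w : sound rs -> peq (normalize rs w) w.
Proof. by move=> rs_sound; apply: (normalize_from_sound _ [::] w rs_sound). Qed.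

Lemma reducts_sound rs p q : sound rs -> q \in reducts rs p -> peq q p.
Proof.
move=> rs_sound /flatten_mapP[k _]; rewrite mem_pmap => /mapP[[l r] lr_rs /=].
case eq_l: drop_prefix => [o|] //= [->]; rewrite catrevE.
rewrite -{2}(cat_take_drop k p) -(revK (take k p)) (drop_prefixP eq_l) rev_cat -catA.
apply: peq_cat; first exact: peq_refl.
apply: peq_cat; last exact: peq_refl.
exact/peq_sym/(rs_sound (l, r)).
Qed.

Lemma orient_sound v w : peq v w -> peq (rev (orient v w).1) (orient v w).2.
Proof. by rewrite /orient; case: ifP => _ vw /=; rewrite revK //; apply: peq_sym. Qed.

Lemma resolve_sound rs p : sound rs -> sound (resolve rs p).
Proof.
move=> rs_sound; rewrite /resolve; set ns := undup _; set m := foldr _ _ _.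
have ns_p q : q \in ns -> peq q p.
  rewrite mem_undup => /mapP[r /(reducts_sound rs_sound) rp ->].
  exact: peq_trans (normalize_sound _ rs_sound) rp.
(* The default value of [head] need not equal [p], so the minimum has to be shown to be one of the
   normal forms. *)
have m_ns : ns != [::] -> m \in ns.
  rewrite /m; case: ns {ns_p m} => //= x s _.
  suff H s' : {subset s' <= x :: s} -> foldr smaller x s' \in x :: s by exact: (H (x :: s)).
  elim: s' => [_|y s' IHs' ys]; first exact: mem_head.
  rewrite /= /smaller; case: ifP => _; first by apply: ys; rewrite mem_head.
  by apply: IHs' => z zs; apply: ys; rewrite inE zs orbT.
move=> lr; rewrite mem_cat => /orP[/mapP[q]|/rs_sound //].
rewrite mem_filter => /andP[_ q_ns] ->; apply: orient_sound.
apply: peq_trans (ns_p _ q_ns) (peq_sym (ns_p _ (m_ns _))).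
by case: (ns) q_ns.
Qed.

Lemma completed_sound : sound completed.
Proof.
rewrite /completed; set s := map wd _.
have: sound [seq orient p.1 p.2 | p <- relations].
  by move=> p /mapP[q /relations_sound /orient_sound q_sound ->].
by elim: s [seq _ | _ <- _] => //= p s IHs rs rs_sound; apply: IHs; apply: resolve_sound.
Qed.

Lemma crulesE : crules = completed.
Proof. by vm_cast_no_check (erefl crules). Qed.

Lemma nf_sound w : peq (nf w) w.
Proof. by apply: normalize_sound; rewrite crulesE; exact: completed_sound. Qed.

Lemma nf_peq a b : nf a == nf b -> peq a b.
Proof.
by move=> /eqP ab; apply: peq_trans (nf_sound b); rewrite -ab; apply/peq_sym/nf_sound.
Qed.

(** * Products of the e_beta with the middle factors *)

Definition nodes_of (s : string) : seq node :=
  pmap (fun x => if x is R i then Some i else None) (wd s).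
Definition rw (s : seq node) : word := map R s.

Lemma rw_cat s t : rw (s ++ t) = rw s ++ rw t.
Proof. exact: map_cat. Qed.

Lemma rw_revl s : peq (rw (rev s) ++ rw s) [::].
Proof.
elim: s => [|i s IHs]; first exact: peq_refl.
rewrite rev_cons -cats1 rw_cat -catA -[rw (i :: s)]/([:: R i] ++ rw s) (catA (rw [:: i])).
have -> : peq (rw [:: i] ++ [:: R i]) [::] by apply/breq_peq/breq_brel/rel_rr.
exact: IHs.
Qed.

Lemma rw_revr s : peq (rw s ++ rw (rev s)) [::].
Proof. by rewrite -{1}(revK s); apply: rw_revl. Qed.

(* The 24 elements e_beta, in normal form. *)
Definition conjugates : seq word := Eval vm_compute in
  iter 9 (fun F => undup (F ++ [seq nf (R i :: f ++ [:: R i]) | f <- F, i <- nodes]))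
    [seq [:: E i] | i <- nodes].

(** Conjugation by $r_i$ permutes the $e_\beta$; recording it by positions turns orbit computations
    into table lookups. *)
Definition action_table : seq (seq nat) := Eval vm_compute in
  [seq [seq index (nf (R i :: f ++ [:: R i])) conjugates | f <- conjugates] | i <- nodes].

Definition act (k : nat) (i : node) : nat := nth 0 (nth [::] action_table (index i nodes)) k.
Definition act_word : nat -> seq node -> nat := foldl act.
Definition conjugate (k : nat) : word := nth [::] conjugates k.

Lemma mem_nodes i : i \in nodes.
Proof. by case: i. Qed.

(** A finite check finds the normal form of each $r_i f r_i$ at the tabulated position; $r_i^2=1$
    then turns this into a rule for moving $r_i$ across $f$. *)
Lemma conj_R k i : k < size conjugates ->
  act k i < size conjugates /\ peq (conjugate k ++ [:: R i]) ([:: R i] ++ conjugate (act k i)).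
Proof.
move=> k_lt.
have /allP/(_ i (mem_nodes i))/allP/(_ k) :
    all (fun i => all (fun k => (act k i < size conjugates) &&
          (nf ([:: R i] ++ conjugate k ++ [:: R i]) == conjugate (act k i)))
        (iota 0 (size conjugates))) nodes.
  by vm_cast_no_check (erefl true).
rewrite mem_iota => /(_ k_lt)/andP[? /eqP <-]; split=> //.
rewrite nf_sound (catA [:: R i] [:: R i]).
have -> : peq ([:: R i] ++ [:: R i]) [::] by apply: (rw_revl [:: i]).
reflexivity.
Qed.

Lemma conj_rw k s : k < size conjugates ->
  act_word k s < size conjugates /\ peq (conjugate k ++ rw s) (rw s ++ conjugate (act_word k s)).
Proof.
elim: s k => [|i s IHs] k k_lt; first by rewrite /= cats0; split=> //; exact: peq_refl.
have [ki_lt ki] := conj_R i k_lt; have [? kis] := IHs _ ki_lt; split=> //.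
rewrite -[rw (i :: s)]/([:: R i] ++ rw s) catA ki -!catA.
by apply: peq_cat; [exact: peq_refl | exact: kis].
Qed.

Lemma E_rw i s : exists2 k, k < size conjugates & peq ([:: E i] ++ rw s) (rw s ++ conjugate k).
Proof.
have Ei : [:: E i] \in conjugates by case: i; vm_cast_no_check (erefl true).
have [k_lt ks] := conj_rw s (etrans (index_mem _ _) Ei).
exists (act_word (index [:: E i] conjugates) s) => //.
by apply: peq_trans ks; rewrite /conjugate nth_index //; exact: peq_refl.
Qed.

(* The core y is equal to the middle factor of one of the eleven forms; left_gens, right_gens and
   common_gens are words for the reflections generating N^L, N^R and C; an entry
   (f, u, z, w) of products states f y = u z w modulo delta, with one f = e_beta for each
   orbit of N^L on the roots. *)
Record family := Family {
  core : string;
  left_gens : seq string;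
  right_gens : seq string;
  common_gens : seq string;
  products : seq (string * string * string * string) }.

Definition family0 : family := (Family ""
  [:: "1"; "2"; "3"; "4"]
  [:: "1"; "2"; "3"; "4"]
  [:: "1"; "2"; "3"; "4"]
  [:: ("a", "", "a", ""); ("c", "43", "d", "34")])%string.

Definition family1 : family := (Family "d"
  [:: "1"; "2"; "3423243"; "4"]
  [:: "1"; "2"; "3423243"; "4"]
  [:: "1"; "2"; "3423243"]
  [:: ("a", "34", "ac", "43"); ("c", "43", "d", ""); ("d", "", "d", "");
      ("3b3", "34", "bc", "43"); ("342c243", "34", "c2c", "43")])%string.

Definition family2 : family := (Family "a"
  [:: "1"; "3"; "4"; "2321232"]
  [:: "1"; "3"; "4"; "2321232"]
  [:: "3"; "4"]
  [:: ("a", "", "a", ""); ("b", "12", "a", ""); ("c", "", "ac", "");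
      ("2c2", "21", "cb", "12"); ("232a232", "232", "a", "")])%string.

(** Up to $\delta$, $r_2$ is absorbed on the right, so $e_{X_3}=e_3\cdot r_2e_3r_2$ shortens to this
    core. *)
Definition family3 : family := (Family "c2c"
  [:: "2"; "3"; "43234"; "12321"]
  [:: "2"; "3"; "43234"; "12321"]
  [:: "12321"]
  [:: ("a", "", "ac2c", ""); ("b", "", "bc", ""); ("c", "", "c2c", "");
      ("d", "34", "c2c", ""); ("43b34", "143234", "ac", "432341");
      ("12c21", "", "c21c2c", "")])%string.

(** Up to $\delta$, the third factor $e_{\epsilon_1+\epsilon_4}$ of $e_{X_4}$ is absorbed by
    $e_1e_3$. *)
Definition family4 : family := (Family "ac"
  [:: "3"; "1"; "2321232"; "34232123243"]
  [:: "3"; "1"; "2321232"; "34232123243"]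
  [::]
  [:: ("a", "", "ac", ""); ("b", "12", "ac", ""); ("c", "", "ac", "");
      ("d", "34", "ac", ""); ("2c2", "", "c2ac", ""); ("42c24", "323432", "ac", "");
      ("232a232", "232", "ac", ""); ("4232a2324", "23432", "ac", "")])%string.

Definition family5 : family := (Family "c21c2c"
  [:: "1"; "2"; "3"; "43234"; "123423212324321"]
  [:: "1"; "2"; "3"; "43234"; "123423212324321"]
  [::]
  [:: ("a", "", "ac2c", ""); ("c", "", "c21c2c", ""); ("d", "34", "c21c2c", "")])%string.

Definition family6 : family := (Family "cb"
  [:: "2"; "3"; "43234"; "12321"]
  [:: "2"; "323"; "43234"; "12321"]
  [:: "12321"]
  [:: ("a", "", "ac", "21"); ("b", "12", "a", "21"); ("c", "", "cb", "");
      ("d", "34", "cb", ""); ("43b34", "143234", "ac", "4321");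
      ("12c21", "", "c2ac", "21")])%string.

Definition family7 : family := (Family "bc"
  [:: "2"; "323"; "43234"; "12321"]
  [:: "2"; "3"; "43234"; "12321"]
  [:: "12321"]
  [:: ("a", "21", "bc", ""); ("b", "", "bc", ""); ("c", "", "c2c", "");
      ("d", "1234", "ac", "432341"); ("3b3", "3", "bc", ""); ("4c4", "3", "d3bcd", "34");
      ("43b34", "343", "bc", ""); ("12c21", "12", "ac2c", "")])%string.

Definition family8 : family := (Family "d3bcd"
  [:: "2"; "4"; "123423212324321"; "323"]
  [:: "2"; "4"; "123423212324321"; "323"]
  [::]
  [:: ("a", "34", "ac", "2342321"); ("b", "1234", "ac", "4321"); ("c", "43", "d3bcd", "");
      ("d", "", "d3bcd", ""); ("3b3", "3", "bc", "43"); ("12c21", "124321", "d3bcd", "");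
      ("3412c2143", "34", "c2ac", "2342321"); ("1234232a2324321", "1232432", "ac2c", "43")])%string.

(** Up to $\delta$, the core equals $e_3e_2e_1e_3$, here with $r_2$ in place of $e_2$; the next
    family has the reversed product. *)
Definition family9 : family := (Family "c2ac"
  [:: "1"; "2"; "3"; "43234"; "123423212324321"]
  [:: "3"; "1"; "2321232"; "34232123243"]
  [::]
  [:: ("a", "", "ac", ""); ("c", "", "c2ac", ""); ("d", "34", "c2ac", "")])%string.

Definition family10 : family := (Family "ac2c"
  [:: "3"; "1"; "2321232"; "34232123243"]
  [:: "1"; "2"; "3"; "43234"; "123423212324321"]
  [::]
  [:: ("a", "", "ac2c", ""); ("b", "12", "ac2c", ""); ("c", "", "ac2c", "");
      ("d", "34", "ac2c", ""); ("2c2", "", "c21c2c", ""); ("42c24", "323432", "ac2c", "");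
      ("232a232", "232", "ac2c", ""); ("4232a2324", "23432", "ac2c", "")])%string.

Definition families : seq family :=
  [:: family0; family1; family2; family3; family4; family5; family6; family7;
      family8; family9; family10].

Definition core_word fm := wd (core fm).
Definition left_words fm := map nodes_of (left_gens fm).
Definition right_words fm := map nodes_of (right_gens fm).
Definition common_words fm := map nodes_of (common_gens fm).

(** A generator of $N$ either lies in $C$ and commutes with the core, or is absorbed by it. Lying in
    $C$ is tested on words, so [common_gens] repeats entries of the generator lists literally. *)
Definition stable (fm : family) : bool :=
  [&& all (fun s => (s \in common_words fm) ||
             (nf (rw s ++ core_word fm) == nf (core_word fm))) (left_words fm),
      all (fun s => (s \in common_words fm) ||
             (nf (core_word fm ++ rw s) == nf (core_word fm))) (right_words fm) &
      all (fun s => nf (rw s ++ core_word fm) == nf (core_word fm ++ rw s)) (common_words fm)].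

Definition row_ok (y : word) (row : string * string * string * string) : bool :=
  let: (f, u, z, w) := row in
  [&& nf (wd f) \in conjugates, wd z \in map core_word families &
      nf (wd f ++ y) == nf (rw (nodes_of u) ++ wd z ++ rw (nodes_of w))].

Definition row_index (row : string * string * string * string) : nat :=
  index (nf (wd row.1.1.1)) conjugates.

(** The positions reached from the rows under the action of $N^L$. That 12 rounds suffice is
    confirmed by [closed], which asks for every position. *)
Definition saturated (fm : family) : seq nat :=
  iter 12 (fun K => undup (K ++ [seq act_word k s | k <- K, s <- left_words fm]))
    (map row_index (products fm)).

Definition closed (fm : family) : bool :=
  all (row_ok (core_word fm)) (products fm) &&
  all (fun k => k \in saturated fm) (iota 0 (size conjugates)).

(** One computation settles all finite facts about the cores: absorption, commutation, the 62 row
    identities, and that the rows reach every $e_\beta$. *)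
Lemma families_ok : all (fun fm => stable fm && closed fm) families.
Proof. by vm_cast_no_check (erefl true). Qed.

Definition spanned (a : word) : Prop := exists u w y,
  y \in map core_word families /\ peq a (rw u ++ y ++ rw w).

Lemma spanned_peq a b : peq a b -> spanned b -> spanned a.
Proof. by move=> ab [u [w [y [? b_y]]]]; exists u, w, y; split=> //; apply: peq_trans b_y. Qed.

Lemma spanned_rwl s a : spanned a -> spanned (rw s ++ a).
Proof.
case=> u [w [y [y_core ay]]]; exists (s ++ u), w, y; split=> //.
by rewrite ay rw_cat -catA; apply: peq_refl.
Qed.

Lemma spanned_rwr s a : spanned a -> spanned (a ++ rw s).
Proof.
case=> u [w [y [y_core ay]]]; exists u, (w ++ s), y; split=> //.
by rewrite ay rw_cat -!catA; apply: peq_refl.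
Qed.

Lemma row_spanned y row : row_ok y row ->
  row_index row < size conjugates /\ spanned (conjugate (row_index row) ++ y).
Proof.
case: row => [[[f u] z] w] /and3P[f_conj z_core /nf_peq fy].
rewrite index_mem; split=> //; exists (nodes_of u), (nodes_of w), (wd z); split=> //.
by rewrite /conjugate nth_index // nf_sound.
Qed.

(* Conjugating by a stabilizing element s of the core y moves e_k y to e_(s k) y. *)
Lemma saturated_spanned fm k : stable fm -> all (row_ok (core_word fm)) (products fm) ->
  k \in saturated fm -> k < size conjugates /\ spanned (conjugate k ++ core_word fm).
Proof.
case/and3P=> /allP left_ok _ /allP common_ok rows_ok; rewrite /saturated.
(* Induction on the number of rounds; round zero consists of the rows themselves. *)
elim: {1}12 k => [|n IHn] k /=.
  elim: (products fm) rows_ok => //= row rows IHr /andP[/row_spanned row_sp /IHr{}IHr].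
  by rewrite inE => /orP[/eqP -> | /IHr].
rewrite mem_undup mem_cat => /orP[/IHn // | /allpairsP[[j s] /= [/IHn[j_lt j_sp] s_left ->]]].
have [? js] := conj_rw s j_lt; split=> //.
(* A generator in $C$ crosses the core unchanged; any other one is absorbed, with [h] empty. *)
have [h hs] : exists h, peq (rw s ++ core_word fm) (core_word fm ++ rw h).
  have /orP[/common_ok/nf_peq|/nf_peq] := left_ok s s_left; first by exists s.
  by exists [::]; rewrite cats0.
apply: (@spanned_peq _ (rw (rev s) ++ (conjugate j ++ core_word fm) ++ rw h)).
  rewrite -catA -hs (catA (conjugate j)) js !catA.
  by setoid_rewrite rw_revl; apply: peq_refl.
exact/spanned_rwl/spanned_rwr.
Qed.

Lemma family_of_core y : y \in map core_word families ->
  exists fm, [/\ core_word fm = y, stable fm & closed fm].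
Proof.
have := families_ok; elim: families => //= fm fms IH /andP[/andP[? ?] /IH{}IH].
by rewrite inE => /orP[/eqP -> | /IH //]; exists fm.
Qed.

(** Letters are added on the left: $r_i$ extends the left factor, $e_i$ crosses that factor and
    meets the core as some $e_\beta$, and $\delta^{\pm1}$ disappears modulo [peq]. *)
Lemma spanned_all a : spanned a.
Proof.
elim: a => [|x a IHa]; first by exists [::], [::], [::]; split=> //; apply: peq_refl.
case: x => [i|i||]; first exact: (spanned_rwl [:: i]).
- case: IHa => u [w [y [y_core ay]]].
  have [k k_lt uk] := E_rw i u.
  have [fm [fm_y fm_stable /andP[rows_ok /allP sat]]] := family_of_core y_core; subst y.
  have [_ ky] : k < size conjugates /\ spanned (conjugate k ++ core_word fm).
    by apply: saturated_spanned => //; apply: sat; rewrite mem_iota.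
  apply: (@spanned_peq _ (rw u ++ (conjugate k ++ core_word fm) ++ rw w)).
    rewrite -[E i :: a]/([:: E i] ++ a) ay catA uk -!catA; exact: peq_refl.
  exact/spanned_rwl/spanned_rwr.
- by apply: spanned_peq IHa; apply: (@peq_delta [:: Dl]).
- by apply: spanned_peq IHa; apply: (@peq_delta [:: Dli]).
Qed.

(** * Reflections and their words *)

Import GRing.Theory.
Local Open Scope ring_scope.

Lemma trmx_mul_dot (a b : vec) : a^T *m b = (dot a b)%:M.
Proof.
apply/matrixP=> i j; rewrite !ord1 !mxE eqxx mulr1n.
by apply: eq_bigr => k _; rewrite mxE.
Qed.

Lemma dot_orthogonal (M : mat) (a b : vec) :
  M^T *m M = 1%:M -> dot (M *m a) (M *m b) = dot a b.
Proof.
move=> MM; have := trmx_mul_dot (M *m a) (M *m b).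
rewrite trmx_mul -mulmxA (mulmxA M^T) MM mul1mx trmx_mul_dot => /matrixP/(_ 0 0).
by rewrite !mxE eqxx !mulr1n.
Qed.

Lemma reflE (a v : vec) : refl a *m v = v - (2%:R / dot a a * dot a v) *: a.
Proof.
by rewrite /refl mulmxBl mul1mx -scalemxAl -mulmxA trmx_mul_dot mul_mx_scalar scalerA.
Qed.

Lemma refl_tr a : (refl a)^T = refl a.
Proof. by rewrite /refl linearB /= linearZ /= trmx1 trmx_mul trmxK. Qed.

Lemma reflN a : refl (- a) = refl a.
Proof.
have dotN : dot (- a) (- a) = dot a a.
  by apply: eq_bigr => i _; rewrite !mxE mulrNN.
by rewrite /refl dotN linearN /= mulmxN mulNmx opprK.
Qed.

Lemma refl_invol a : refl a *m refl a = 1%:M.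
Proof.
rewrite {2}/refl mulmxBr mulmx1 -scalemxAr mulmxA reflE.
(* If $a\cdot a=0$, division by zero gives 0 and [refl a] is the identity. *)
have [a0|a0] := eqVneq (dot a a) 0.
  by rewrite /refl a0 invr0 mulr0 !scale0r !subr0.
have -> : a - 2%:R / dot a a * dot a a *: a = - a.
  by rewrite divfK // scaler_nat mulr2n opprD addNKr.
by rewrite mulNmx scalerN opprK /refl subrK.
Qed.

Lemma refl_orthogonal (M : mat) a : M^T *m M = 1%:M -> refl (M *m a) = M *m refl a *m M^T.
Proof.
move=> MM; rewrite /refl dot_orthogonal // mulmxBr mulmxBl mulmx1 (mulmx1C MM).
by rewrite -scalemxAr -scalemxAl trmx_mul !mulmxA.
Qed.

Lemma wmat_cat s t : wmat (s ++ t) = wmat s *m wmat t.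
Proof. by elim: s => [|i s IHs] /=; rewrite ?mul1mx // IHs mulmxA. Qed.

Lemma wmat_rev s : wmat (rev s) = (wmat s)^T.
Proof.
elim: s => [|i s IHs]; first by rewrite /= trmx1.
by rewrite rev_cons -cats1 wmat_cat IHs /= mulmx1 trmx_mul refl_tr.
Qed.

Lemma wmat_orthogonal s : (wmat s)^T *m wmat s = 1%:M.
Proof.
elim: s => [|i s IHs] /=; first by rewrite trmx1 mulmx1.
by rewrite trmx_mul mulmxA -(mulmxA _ _ (refl _)) refl_tr refl_invol mulmx1.
Qed.

Lemma wmat_unit s : wmat s \in unitmx.
Proof. by have [] := mulmx1_unit (wmat_orthogonal s). Qed.

Lemma invmx_wmat s : invmx (wmat s) = wmat (rev s).
Proof.
by rewrite -[LHS]mul1mx -(wmat_orthogonal s) -mulmxA mulmxV ?wmat_unit // mulmx1 wmat_rev.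
Qed.

(** The same condition as in [ebeta], so one witness yields both a word for the reflection in [b]
    and a word for $e_b$. *)
Definition root_at (t : seq node) (j : node) (b : vec) : Prop :=
  wmat t *m beta j = b \/ wmat t *m beta j = - b.

Lemma refl_root_at t j b : root_at t j b -> refl b = wmat (t ++ j :: rev t).
Proof.
have -> : wmat (t ++ j :: rev t) = refl (wmat t *m beta j).
  by rewrite wmat_cat /= wmat_rev mulmxA (refl_orthogonal _ (wmat_orthogonal t)).
by case=> ->; rewrite ?reflN.
Qed.

(** * The roots in coordinates *)

Definition vec4 (x y z w : rat) : vec := \col_i [:: x; y; z; w]`_i.

Lemma vec4P (v : vec) x y z w :
  v 0 0 = x -> v 1 0 = y -> v 2 0 = z -> v 3 0 = w -> v = vec4 x y z w.
Proof.
move=> <- <- <- <-; apply/colP=> -[[|[|[|[|?]]]] i_lt] //; rewrite !mxE;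
  by congr (v _ _); apply: val_inj.
Qed.

Lemma epsE : (eps1 = vec4 1 0 0 0) * (eps2 = vec4 0 1 0 0) *
  (eps3 = vec4 0 0 1 0) * (eps4 = vec4 0 0 0 1).
Proof. by do !split; apply: vec4P; rewrite !mxE. Qed.

Lemma vec4D x y z w x' y' z' w' :
  vec4 x y z w + vec4 x' y' z' w' = vec4 (x + x') (y + y') (z + z') (w + w').
Proof. by apply: vec4P; rewrite !mxE. Qed.

Lemma vec4N x y z w : - vec4 x y z w = vec4 (- x) (- y) (- z) (- w).
Proof. by apply: vec4P; rewrite !mxE. Qed.

Lemma vec4Z c x y z w : c *: vec4 x y z w = vec4 (c * x) (c * y) (c * z) (c * w).
Proof. by apply: vec4P; rewrite !mxE. Qed.

Definition vec4E := (epsE, vec4N, vec4D, vec4Z).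

Lemma dot_vec4 x y z w x' y' z' w' :
  dot (vec4 x y z w) (vec4 x' y' z' w') = x * x' + y * y' + z * z' + w * w'.
Proof. by rewrite /dot !big_ord_recl big_ord0 !mxE /= addr0 !addrA. Qed.

Lemma vec4_eq x y z w x' y' z' w' : x = x' -> y = y' -> z = z' -> w = w' ->
  vec4 x y z w = vec4 x' y' z' w'.
Proof. by move=> -> -> -> ->. Qed.

(** With these formulas a root is checked by rational arithmetic on four coordinates, without
    multiplying matrices. *)
Lemma refl_beta x y z w :
  (refl (beta n1) *m vec4 x y z w =
     vec4 (Defs.half * (x + y + z + w)) (Defs.half * (x + y - z - w))
          (Defs.half * (x - y + z - w)) (Defs.half * (x - y - z + w))) *
  (refl (beta n2) *m vec4 x y z w = vec4 x (- y) z w) *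
  (refl (beta n3) *m vec4 x y z w = vec4 x z y w) *
  (refl (beta n4) *m vec4 x y z w = vec4 x y w z).
Proof.
by do !split; rewrite reflE /= /beta1 /beta2 /beta3 /beta4 !vec4E !dot_vec4 /Defs.half;
  apply: vec4_eq; field.
Qed.

Lemma wmat_cons i s (v : vec) : wmat (i :: s) *m v = refl (beta i) *m (wmat s *m v).
Proof. by rewrite /= mulmxA. Qed.

Lemma wmat_nil (v : vec) : wmat [::] *m v = v.
Proof. exact: mul1mx. Qed.

Lemma betaE : (beta n1 = vec4 Defs.half (- Defs.half) (- Defs.half) (- Defs.half)) *
  (beta n2 = vec4 0 1 0 0) * (beta n3 = vec4 0 (- 1) 1 0) * (beta n4 = vec4 0 0 (- 1) 1).
Proof.
by do !split; rewrite /= /beta1 /beta2 /beta3 /beta4 !vec4E; apply: vec4_eq; ring.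
Qed.

Ltac compute_root :=
  rewrite /root_at betaE !wmat_cons wmat_nil !refl_beta ?vec4E;
  first [left; apply: vec4_eq; rewrite /Defs.half; field
        | right; apply: vec4_eq; rewrite /Defs.half; field].

(** In these names [D] reads plus and [B] reads minus. For the subgroup generators, [t], [j] and the
    reversed [t] spell, letter for letter, the word listed in the family. *)
Lemma root_e3De2 : root_at [:: n2] n3 (eps3 + eps2).
Proof. by compute_root. Qed.

Lemma root_e4De3 : root_at [:: n3; n4; n2] n3 (eps4 + eps3).
Proof. by compute_root. Qed.

Lemma root_e1De2De3Be4 :
  root_at [:: n2; n3; n2] n1 (Defs.half *: (eps1 + eps2 + eps3 - eps4)).
Proof. by compute_root. Qed.

Lemma root_e1Be2De3De4 :
  root_at [:: n3; n4; n2; n3; n2] n1 (Defs.half *: (eps1 - eps2 + eps3 + eps4)).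
Proof. by compute_root. Qed.

Lemma root_e4 : root_at [:: n4; n3] n2 eps4.
Proof. by compute_root. Qed.

Lemma root_e3 : root_at [:: n3] n2 eps3.
Proof. by compute_root. Qed.

Lemma root_e1 : root_at [:: n1; n2; n3; n4; n2; n3; n2] n1 eps1.
Proof. by compute_root. Qed.

Lemma root_e4Be1 : root_at [:: n1; n2] n3 (eps4 - eps1).
Proof. by compute_root. Qed.

Lemma root_e4De1 : root_at [:: n4; n3; n2; n3; n4; n1; n2] n3 (eps4 + eps1).
Proof. by compute_root. Qed.

Lemma root_e1De4 : root_at [:: n4; n3; n2; n3; n4; n1; n2] n3 (eps1 + eps4).
Proof. by rewrite addrC; exact: root_e4De1. Qed.

Lemma root_beta j : root_at [::] j (beta j).
Proof. by left; rewrite wmat_nil. Qed.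

(** * Words for the subgroups and for coset representatives *)

Fixpoint spells (L : seq vec) (W : seq (seq node)) : Prop :=
  match L, W with
  | [::], [::] => True
  | b :: L', s :: W' => refl b = wmat s /\ spells L' W'
  | _, _ => False
  end.

Lemma spells_word L W b : spells L W -> b \in L -> exists2 s, s \in W & refl b = wmat s.
Proof.
elim: L W => [|c L IHL] [|s W] //= [cs /IHL{}IHL].
rewrite inE => /orP[/eqP->|/IHL[t tW bt]]; first by exists s; rewrite ?mem_head.
by exists t; rewrite // inE tW orbT.
Qed.

Lemma spells_root L W s : spells L W -> s \in W -> exists2 b, b \in L & refl b = wmat s.
Proof.
elim: L W => [|c L IHL] [|t W] //= [ct /IHL{}IHL].
rewrite inE => /orP[/eqP->|/IHL[b bL bs]]; first by exists c; rewrite ?mem_head.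
by exists b; rewrite // inE bL orbT.
Qed.

Lemma gen_by_words L W g : spells L W -> gen_by L g ->
  exists2 ss : seq (seq node), {subset ss <= W} & g = wmat (flatten ss).
Proof.
move=> LW [bs [/allP bsL ->]]; elim: bs bsL => [|b bs IHbs] bsL; first by exists [::].
have [s sW bs_s] := spells_word LW (bsL b (mem_head _ _)).
have [|ss ssW ss_bs] := IHbs; first by move=> c c_bs; apply: bsL; rewrite inE c_bs orbT.
exists (s :: ss); last by rewrite /= wmat_cat bs_s ss_bs.
by move=> t; rewrite inE => /orP[/eqP->|/ssW].
Qed.

Lemma words_gen_by L W (ss : seq (seq node)) : spells L W -> {subset ss <= W} ->
  gen_by L (wmat (flatten ss)).
Proof.
move=> LW; elim: ss => [|s ss IHss] ssW; first by exists [::].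
have [b bL bs] := spells_root LW (ssW s (mem_head _ _)).
have [|bs' [bs'L ss_bs]] := IHss; first by move=> t t_ss; apply: ssW; rewrite inE t_ss orbT.
by exists (b :: bs'); rewrite /= bL bs'L wmat_cat ss_bs bs.
Qed.

Lemma inW_wmat u : inW (wmat u).
Proof.
exists (map beta u); split; last by rewrite /wmat foldr_map.
by apply/allP=> b /mapP[[] _ ->]; rewrite !inE eqxx ?orbT.
Qed.

Lemma inW_words g : inW g -> exists s, g = wmat s.
Proof.
case=> bs [/allP bsW ->]; elim: bs bsW => [|b bs IHbs] bsW; first by exists [::].
have [|s bs_s] := IHbs; first by move=> c c_bs; apply: bsW; rewrite inE c_bs orbT.
have := bsW b (mem_head _ _); rewrite !inE => /or4P[] /eqP->;
  [exists (n1 :: s)|exists (n2 :: s)|exists (n3 :: s)|exists (n4 :: s)]; by rewrite /= bs_s.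
Qed.

(* The word of the representative is chosen as u n^-1, so that no presentation of W is needed. *)
Lemma coset_factor L W D u : coset_reps (gen_by L) D -> spells L W ->
  exists su ss, [/\ D (wmat su), {subset ss <= W} & peq (rw u) (rw su ++ rw (flatten ss))].
Proof.
move=> [DW Dcosets] LW; have [d [[Dd dN] _]] := Dcosets _ (inW_wmat u).
have [ss ssW du] := gen_by_words LW dN.
exists (u ++ rev (flatten ss)), ss; split=> //.
  (* With $n=d^{-1}u$, the matrix of the chosen word is $un^{-1}=uu^{-1}d=d$. *)
  suff -> : wmat (u ++ rev (flatten ss)) = d by [].
  have [s ds] := inW_words (DW _ Dd).
  rewrite wmat_cat -invmx_wmat -du ds invmx_wmat.
  have -> : wmat (rev s) *m wmat u = wmat (rev s ++ u) by rewrite wmat_cat.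
  rewrite invmx_wmat rev_cat revK wmat_cat mulmxA.
  by rewrite -(invmx_wmat u) mulmxV ?wmat_unit // mul1mx.
by rewrite rw_cat -catA; setoid_rewrite rw_revl; rewrite cats0; apply: peq_refl.
Qed.

(** The two reversals keep the order of the words and reverse each one; every word spells a
    reflection, which is its own inverse, so the product is unchanged. *)
Lemma wmat_rev_words L W (ss : seq (seq node)) : spells L W -> {subset ss <= W} ->
  wmat (rev (flatten (rev ss))) = wmat (flatten ss).
Proof.
move=> LW; elim: ss => // s ss IHss ssW.
have [b _ bs] := spells_root LW (ssW s (mem_head _ _)).
rewrite rev_cons flatten_rcons rev_cat !wmat_cat wmat_rev -bs refl_tr IHss //.
by move=> t t_ss; apply: ssW; rewrite inE t_ss orbT.
Qed.

(** The coset of $w^{-1}$ is used: $n=d^{-1}w^{-1}$ gives $w=n^{-1}d^{-1}$, where $n^{-1}$ is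
    spelled by the words for $n$ in reverse order and $d^{-1}=nw$ supplies the word for the
    representative. *)
Lemma coset_factor_inv L W D w : coset_reps (gen_by L) D -> spells L W ->
  exists sw ss d, [/\ D d, invmx d = wmat sw, {subset ss <= W} &
                      peq (rw w) (rw (flatten ss) ++ rw sw)].
Proof.
move=> [DW Dcosets] LW; have [d [[Dd dN] _]] := Dcosets _ (inW_wmat (rev w)).
have [ss ssW dw] := gen_by_words LW dN.
exists (rev (flatten (rev ss)) ++ w), (rev ss), d; split=> //.
- rewrite wmat_cat (wmat_rev_words LW) // -dw -mulmxA -wmat_cat.
  by rewrite wmat_cat wmat_rev wmat_orthogonal mulmx1.
- by move=> s; rewrite mem_rev; apply: ssW.
by rewrite rw_cat catA; setoid_rewrite rw_revr; apply: peq_refl.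
Qed.

(** * Absorbing subgroup elements into the core *)

Lemma absorb_left fm (ss : seq (seq node)) : stable fm -> {subset ss <= left_words fm} ->
  exists2 cs : seq (seq node), {subset cs <= common_words fm} &
    peq (rw (flatten ss) ++ core_word fm) (core_word fm ++ rw (flatten cs)).
Proof.
case/and3P=> /allP left_ok _ /allP common_ok.
elim: ss => [|s ss IHss] ssW.
  by exists [::] => //; rewrite /= cats0; apply: peq_refl.
have [|cs csW ss_cs] := IHss; first by move=> t t_ss; apply: ssW; rewrite inE t_ss orbT.
rewrite /= rw_cat -catA.
have [sC|sNC] := boolP (s \in common_words fm).
  exists (s :: cs); first by move=> t; rewrite inE => /orP[/eqP->|/csW].
  rewrite ss_cs catA (nf_peq (common_ok s sC)) -catA -rw_cat; exact: peq_refl.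
exists cs => //; have := left_ok s (ssW s (mem_head _ _)).
rewrite (negPf sNC) => /nf_peq s_core.
by rewrite ss_cs catA s_core; apply: peq_refl.
Qed.

Lemma common_commute fm (cs : seq (seq node)) : stable fm -> {subset cs <= common_words fm} ->
  peq (rw (flatten cs) ++ core_word fm) (core_word fm ++ rw (flatten cs)).
Proof.
case/and3P=> _ _ /allP common_ok; elim: cs => [|s cs IHcs] csW.
  by rewrite /= cats0; apply: peq_refl.
have s_core := nf_peq (common_ok s (csW s (mem_head _ _))).
rewrite /= rw_cat -catA IHcs; last by move=> t t_cs; apply: csW; rewrite inE t_cs orbT.
by rewrite catA s_core -catA; apply: peq_refl.
Qed.

Lemma absorb_right fm (ss : seq (seq node)) : stable fm -> {subset ss <= right_words fm} ->
  exists2 cs : seq (seq node), {subset cs <= common_words fm} &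
    peq (core_word fm ++ rw (flatten ss)) (core_word fm ++ rw (flatten cs)).
Proof.
move=> fm_ok; have /and3P[_ /allP right_ok _] := fm_ok.
elim/last_ind: ss => [|ss s IHss] ssW; first by exists [::] => //; apply: peq_refl.
have [|cs csW ss_cs] := IHss.
  by move=> t t_ss; apply: ssW; rewrite mem_rcons inE t_ss orbT.
rewrite flatten_rcons rw_cat catA.
have [sC|sNC] := boolP (s \in common_words fm).
  exists (rcons cs s); first by move=> t; rewrite mem_rcons inE => /orP[/eqP->|/csW].
  by rewrite ss_cs flatten_rcons rw_cat catA; apply: peq_refl.
exists cs => //; have := right_ok s (ssW s _); rewrite mem_rcons mem_head => /(_ isT).
rewrite (negPf sNC) => /nf_peq core_s.
(* [s] is absorbed only next to the core, so the factor in $C$ is first carried over to the left of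
   the core. *)
by rewrite ss_cs -(common_commute fm_ok csW) -catA core_s; apply: peq_refl.
Qed.

(** The parts in $C$ left over from both sides are collected to the right of the core and form the
    factor $v$. *)
Lemma family_factor fm LL LR (DL DR : mat -> Prop) u w : stable fm ->
  coset_reps (gen_by LL) DL -> spells LL (left_words fm) ->
  coset_reps (gen_by LR) DR -> spells LR (right_words fm) ->
  exists su cs sw d, [/\ DL (wmat su), {subset cs <= common_words fm}, DR d, invmx d = wmat sw &
    peq (rw u ++ core_word fm ++ rw w) (rw su ++ core_word fm ++ rw (flatten cs) ++ rw sw)].
Proof.
move=> fm_ok DLok LLok DRok LRok.
have [su [ls [su_D ls_left u_su]]] := coset_factor u DLok LLok.
have [sw [rs [d [dD d_sw rs_right w_sw]]]] := coset_factor_inv w DRok LRok.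
have [cs csC ls_cs] := absorb_left fm_ok ls_left.
have [ds dsC rs_ds] := absorb_right fm_ok rs_right.
exists su, (cs ++ ds), sw, d; split=> //.
  by move=> s; rewrite mem_cat => /orP[/csC|/dsC].
rewrite u_su w_sw -catA; apply: peq_cat; first exact: peq_refl.
rewrite catA ls_cs -(common_commute fm_ok csC) -catA (catA (core_word fm)) rs_ds.
rewrite catA (catA (rw _) (core_word fm)) (common_commute fm_ok csC) flatten_cat rw_cat -!catA.
exact: peq_refl.
Qed.

(** [x] is the word that the form prescribes for the middle factor; comparing normal forms lets it
    replace the core. *)
Lemma family_form_v fm LL LR LC (DL DR : mat -> Prop) (Xw : word -> Prop) x u w : stable fm ->
  coset_reps (gen_by LL) DL -> spells LL (left_words fm) ->
  coset_reps (gen_by LR) DR -> spells LR (right_words fm) ->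
  spells LC (common_words fm) -> Xw x -> nf (core_word fm) == nf x ->
  exists2 b, peq (rw u ++ core_word fm ++ rw w) b & form_v DL Xw (gen_by LC) DR b.
Proof.
move=> fm_ok DLok LLok DRok LRok LCok xX /nf_peq core_x.
have [su [cs [sw [d [su_D csC dD d_sw uw]]]]] := family_factor u w fm_ok DLok LLok DRok LRok.
exists (rw su ++ x ++ rw (flatten cs) ++ rw sw).
  by rewrite uw core_x; apply: peq_refl.
exists (wmat su), (wmat (flatten cs)), d, (rw su), x, (rw (flatten cs)), (rw sw); split=> //.
  exact: words_gen_by csC.
by split=> //; [exists su | exists (flatten cs) | exists sw].
Qed.

Lemma family_form_nov fm LL LR (DL DR : mat -> Prop) x u w : stable fm ->
  coset_reps (gen_by LL) DL -> spells LL (left_words fm) ->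
  coset_reps (gen_by LR) DR -> spells LR (right_words fm) ->
  common_gens fm = [::] -> nf (core_word fm) == nf x ->
  exists2 b, peq (rw u ++ core_word fm ++ rw w) b & form_nov DL (eq x) DR b.
Proof.
move=> fm_ok DLok LLok DRok LRok C0 /nf_peq core_x.
have [su [cs [sw [d [su_D csC dD d_sw uw]]]]] := family_factor u w fm_ok DLok LLok DRok LRok.
have {csC} cs0 : cs = [::].
  by case: cs csC {uw} => // s cs /(_ s (mem_head _ _)); rewrite /common_words C0.
exists (rw su ++ x ++ rw sw); first by rewrite uw core_x cs0; apply: peq_refl.
exists (wmat su), d, (rw su), x, (rw sw); split=> //.
by split=> //; [exists su | exists sw].
Qed.

(** * Generators of the eleven families and the final case analysis *)

Lemma refl_beta_word j : refl (beta j) = wmat [:: j].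
Proof. by rewrite /= mulmx1. Qed.

Local Notation "a ,, b" := (conj a b) (at level 60, right associativity).
Local Notation r j := (refl_beta_word j).

Lemma spells_left0 : spells [:: beta1; beta2; beta3; beta4] (left_words family0).
Proof. exact: (r n1 ,, r n2 ,, r n3 ,, r n4 ,, I). Qed.

Lemma spells_left1 : spells [:: beta1; beta2; eps4 + eps3; beta4] (left_words family1).
Proof. exact: (r n1 ,, r n2 ,, refl_root_at root_e4De3 ,, r n4 ,, I). Qed.

Lemma spells_common1 : spells [:: beta1; beta2; eps4 + eps3] (common_words family1).
Proof. exact: (r n1 ,, r n2 ,, refl_root_at root_e4De3 ,, I). Qed.

Lemma spells_left2 : spells
  [:: beta1; beta3; beta4; Defs.half *: (eps1 + eps2 + eps3 - eps4)] (left_words family2).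
Proof. exact: (r n1 ,, r n3 ,, r n4 ,, refl_root_at root_e1De2De3Be4 ,, I). Qed.

Lemma spells_common2 : spells [:: beta3; beta4] (common_words family2).
Proof. exact: (r n3 ,, r n4 ,, I). Qed.

Lemma spells_left3 : spells [:: beta2; beta3; eps4; eps4 - eps1] (left_words family3).
Proof. exact: (r n2 ,, r n3 ,, refl_root_at root_e4 ,, refl_root_at root_e4Be1 ,, I). Qed.

Lemma spells_common3 : spells [:: eps4 - eps1] (common_words family3).
Proof. exact: (refl_root_at root_e4Be1 ,, I). Qed.

Lemma spells_left4 : spells
  [:: beta3; beta1; Defs.half *: (eps1 + eps2 + eps3 - eps4);
      Defs.half *: (eps1 - eps2 + eps3 + eps4)] (left_words family4).
Proof.
exact: (r n3 ,, r n1 ,, refl_root_at root_e1De2De3Be4 ,,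
        refl_root_at root_e1Be2De3De4 ,, I).
Qed.

Lemma spells_left5 : spells [:: beta1; beta2; beta3; eps4; eps1] (left_words family5).
Proof.
exact: (r n1 ,, r n2 ,, r n3 ,, refl_root_at root_e4 ,, refl_root_at root_e1 ,, I).
Qed.

Lemma spells_right6 : spells [:: beta2; eps3; eps4; eps4 - eps1] (right_words family6).
Proof.
exact: (r n2 ,, refl_root_at root_e3 ,, refl_root_at root_e4 ,,
        refl_root_at root_e4Be1 ,, I).
Qed.

Lemma spells_left8 : spells [:: beta2; beta4; eps1; eps3] (left_words family8).
Proof.
exact: (r n2 ,, r n4 ,, refl_root_at root_e1 ,, refl_root_at root_e3 ,, I).
Qed.

Lemma ebeta_root t j b : root_at t j b -> ebeta b (rw t ++ E j :: rw (rev t)).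
Proof. by exists t, j. Qed.

Lemma eprod_nil : eprod [::] [::].
Proof. by []. Qed.

Lemma eprod_cons b X x y : ebeta b x -> eprod X y -> eprod (b :: X) (x ++ y).
Proof. by exists x, y. Qed.

Theorem theorem4p4 (D0 D1 D2 D3 D4 D5 D6L D6R D8 : mat -> Prop)
  (h0 : coset_reps N0 D0) (h1 : coset_reps N1 D1) (h2 : coset_reps N2 D2)
  (h3 : coset_reps N3 D3) (h4 : coset_reps N4 D4) (h5 : coset_reps N5 D5)
  (h6L : coset_reps N6L D6L) (h6R : coset_reps N6R D6R) (h8 : coset_reps N8 D8)
  (a : word) :
  exists (k : int) (b : word), breq a (dpow k ++ b) /\
    (form_v D0 (eprod X0) C0 D0 b \/
     form_v D1 (eprod X1) C1 D1 b \/
     form_v D2 (eprod X2) C2 D2 b \/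
     form_v D3 (eprod X3) C3 D3 b \/
     form_v D4 (eprod X4) C4 D4 b \/
     form_v D5 (eprod X5) C5 D5 b \/
     form_v D6L (eq [:: E n3; E n2]) C6 D6R b \/
     form_v D6R (eq [:: E n2; E n3]) C6 D6L b \/
     form_nov D8 (eq [:: E n4; R n3; E n2; E n3; E n4]) D8 b \/
     form_nov D5 (eq [:: E n3; E n2; E n1; E n3]) D4 b \/
     form_nov D4 (eq [:: E n3; E n1; E n2; E n3]) D5 b).
Proof.
have [u [w [y [y_core a_uyw]]]] := spanned_all a.
(* Explicit words for $e_{X_1},\dots,e_{X_5}$, built from the witnesses for their roots. *)
pose X1w := eprod_cons (ebeta_root (root_beta n4)) eprod_nil.
pose X2w := eprod_cons (ebeta_root (root_beta n1)) eprod_nil.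
pose X3w := eprod_cons (ebeta_root (root_beta n3))
  (eprod_cons (ebeta_root root_e3De2) eprod_nil).
pose X4w := eprod_cons (ebeta_root (root_beta n1)) (eprod_cons (ebeta_root (root_beta n3))
  (eprod_cons (ebeta_root root_e1De4) eprod_nil)).
pose X5w := eprod_cons (ebeta_root (root_beta n3)) (eprod_cons (ebeta_root root_e3De2)
  (eprod_cons (ebeta_root root_e4De1) (eprod_cons (ebeta_root root_e4Be1) eprod_nil))).
(* It is enough to work modulo $\delta$; the exponent $k$ is restored afterwards. *)
suff [b ab b_form] : exists2 b, peq a b &
    (form_v D0 (eprod X0) C0 D0 b \/ form_v D1 (eprod X1) C1 D1 b \/
     form_v D2 (eprod X2) C2 D2 b \/ form_v D3 (eprod X3) C3 D3 b \/
     form_v D4 (eprod X4) C4 D4 b \/ form_v D5 (eprod X5) C5 D5 b \/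
     form_v D6L (eq [:: E n3; E n2]) C6 D6R b \/ form_v D6R (eq [:: E n2; E n3]) C6 D6L b \/
     form_nov D8 (eq [:: E n4; R n3; E n2; E n3; E n4]) D8 b \/
     form_nov D5 (eq [:: E n3; E n2; E n1; E n3]) D4 b \/
     form_nov D4 (eq [:: E n3; E n1; E n2; E n3]) D5 b).
  by have [k ak] := peq_dpow ab; exists k, b.
have stable_nth i : (i < 11)%N -> stable (nth family0 families i).
  by move=> i_lt; have /(all_nthP family0)/(_ i i_lt)/andP[] := families_ok.
have weaken (P Q : word -> Prop) : (forall b, P b -> Q b) ->
    (exists2 b, peq (rw u ++ y ++ rw w) b & P b) -> exists2 b, peq a b & Q b.
  by move=> PQ [b uyw /PQ]; exists b => //; apply: peq_trans uyw.
have /(nthP [::])[i] := y_core; rewrite size_map => i_lt.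
rewrite (nth_map family0) // => yE; have i_stable := stable_nth i i_lt.
subst y; move: i_stable weaken i_lt {y_core a_uyw stable_nth}.
case: i => [|[|[|[|[|[|[|[|[|[|[|i]]]]]]]]]]] fm_ok weaken i_lt; last by [].
- apply: (weaken _ _ _ (family_form_v u w fm_ok
    h0 spells_left0 h0 spells_left0 spells_left0 eprod_nil _)) => [b|]; first by tauto.
  by vm_cast_no_check (erefl true).
- apply: (weaken _ _ _ (family_form_v u w fm_ok
    h1 spells_left1 h1 spells_left1 spells_common1 X1w _)) => [b|]; first by tauto.
  by vm_cast_no_check (erefl true).
- apply: (weaken _ _ _ (family_form_v u w fm_ok
    h2 spells_left2 h2 spells_left2 spells_common2 X2w _)) => [b|]; first by tauto.
  by vm_cast_no_check (erefl true).
- apply: (weaken _ _ _ (family_form_v u w fm_ok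
    h3 spells_left3 h3 spells_left3 spells_common3 X3w _)) => [b|]; first by tauto.
  by vm_cast_no_check (erefl true).
(* $C_4$ is trivial: its generator list and its word list are both empty, so [I] proves that they
   match. *)
- apply: (weaken _ _ _ (family_form_v u w fm_ok
    h4 spells_left4 h4 spells_left4 (I : spells [::] (common_words family4)) X4w _))
    => [b|]; first by tauto.
  by vm_cast_no_check (erefl true).
- apply: (weaken _ _ _ (family_form_v u w fm_ok
    h5 spells_left5 h5 spells_left5 (I : spells [::] (common_words family5)) X5w _))
    => [b|]; first by tauto.
  by vm_cast_no_check (erefl true).
- apply: (weaken _ _ _ (family_form_v (Xw := eq [:: E n3; E n2]) u w fm_ok
    h6L spells_left3 h6R spells_right6 spells_common3 (erefl _) _)) => [b|]; first by tauto.
  by vm_cast_no_check (erefl true).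
(* Since $D_7^L=D_6^R$ and $D_7^R=D_6^L$, the two sides of the previous case are exchanged. *)
- apply: (weaken _ _ _ (family_form_v (Xw := eq [:: E n2; E n3]) u w fm_ok
    h6R spells_right6 h6L spells_left3 spells_common3 (erefl _) _)) => [b|]; first by tauto.
  by vm_cast_no_check (erefl true).
- apply: (weaken _ _ _ (family_form_nov (x := [:: E n4; R n3; E n2; E n3; E n4]) u w fm_ok
    h8 spells_left8 h8 spells_left8 (erefl _) _)) => [b|]; first by tauto.
  by vm_cast_no_check (erefl true).
- apply: (weaken _ _ _ (family_form_nov (x := [:: E n3; E n2; E n1; E n3]) u w fm_ok
    h5 spells_left5 h4 spells_left4 (erefl _) _)) => [b|]; first by tauto.
  by vm_cast_no_check (erefl true).
- apply: (weaken _ _ _ (family_form_nov (x := [:: E n3; E n1; E n2; E n3]) u w fm_ok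
    h4 spells_left4 h5 spells_left5 (erefl _) _)) => [b|]; first by tauto.
  by vm_cast_no_check (erefl true).
Qed.
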